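(* Let $d\ge 3$ and let $P=\mathrm{conv}\{A_0,\ldots,A_d\}$ be a cyclic polygon with circumcenter $M$ and circumradius $R$ in a normed plane $(\mathbb{R}^2,\|\cdot\|)$. For $i=0,\dots,d$ let $P_i=\mathrm{conv}(\{A_0,\ldots,A_d\}\setminus\{A_i\})$. Then: (a) The complementary point $P_M$ of $P$ is common to all the circles $S(P_M^{i},R)$, $i=0,\ldots,d$, where $P_M^{i}$ is the complementary point of the subpolygon $P_i$ with respect to the circumcenter $M$. (b) The lines $\langle A_iP_M^{i}\rangle$ are concurrent in $C_M$, where $C_M:=M+\frac12\sum_{i=0}^d(A_i-M)$ is the midpoint of $[MP_M]$, called the spatial center of $P$ with respect to $M$. (c) The midpoints $E_i$ of the segments joining the vertices $A_i$, $i=0,\ldots,d$, with the complementary point $P_M$ are concyclic in the circle $S(C_M,\frac R2)$. (d) The point $C_M$ is common to all the circles $S(C_M^{i},\frac R2)$, where $C_M^{i}$ is the spatial center of the subpolygon $P_i$ with respect to the circumcenter $M$, $i=0,\ldots,d$, and the points $C_M^{i}$ also lie on the circle $S(C_M,\frac R2)$.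
   Context: A normed (Minkowski) plane $(\mathbb{R}^2,\|\cdot\|)$ is $\mathbb{R}^2$ with an arbitrary norm; $S(X,r)=\{Y:\|Y-X\|=r\}$. A cyclic polygon $P=\mathrm{conv}\{A_0,\ldots,A_d\}$ is a convex polygon whose (pairwise distinct) vertices $A_0,\dots,A_d$ all lie on some circle $S(M,R)$, $R>0$; then $M$ is called a circumcenter and $R$ the corresponding circumradius of $P$. The point $M$ is then also a circumcenter of each subpolygon $P_i$. $\langle XY\rangle$ denotes the line through two distinct points $X,Y$, and $[XY]$ the closed segment; in (b) only those indices $i$ with $A_i\ne P_M^i$, for which the line is well-defined, are considered. For a cyclic polygon with vertex set $V$ and circumcenter $M$, the complementary point with respect to $M$ is $M+\sum_{A\in V}(A-M)$ and the spatial center with respect to $M$ is $M+\frac12\sum_{A\in V}(A-M)$. Thus $P_M=M+\sum_{j=0}^d(A_j-M)$, $P_M^i=M+\sum_{j\ne i}(A_j-M)$, $C_M^i=M+\frac12\sum_{j\neq i}(A_j-M)$. The same formulas are used for triangles (the subpolygons when $d=3$). *)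

(* Defs.v *)
From HB Require Import structures.
From mathcomp Require Import all_boot all_order all_algebra.
From mathcomp Require Import boolp classical_sets functions fsbigop reals.
From mathcomp Require Import interval_inference convex.

Set Implicit Arguments.
Unset Strict Implicit.
Unset Printing Implicit Defensive.
Import Order.TTheory GRing.Theory Num.Theory.
Local Open Scope classical_set_scope.
Local Open Scope ring_scope.

(* The norm is an explicit function because the canonical norm of 'rV[R]_2 is
   the sup norm. Nonnegativity follows from the three axioms. *)
Definition is_norm (R : realType) (N : 'rV[R]_2 -> R) : Prop :=
  [/\ forall x, N x = 0 -> x = 0,
      forall (a : R) x, N (a *: x) = `|a| * N x
    & forall x y, N (x + y) <= N x + N y].

Definition circle (R : realType) (N : 'rV[R]_2 -> R) (X : 'rV[R]_2) (r : R) :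
  set 'rV[R]_2 := [set Y | N (Y - X) = r].

Definition midpoint (R : realType) (X Y : 'rV[R]_2) : 'rV[R]_2 :=
  2^-1 *: (X + Y).

(* For X = Y this set is the single point X. *)
Definition line (R : realType) (X Y : 'rV[R]_2) : set 'rV[R]_2 :=
  [set (1 - t) *: X + t *: Y | t in [set: R]].

Definition convex_hull (R : realType) (F : set 'rV[R]_2) : set 'rV[R]_2 :=
  smallest (@convex_set R 'rV[R]_2) F.

(* Vertices of a convex polygon are its extreme points. *)
Definition vertices (R : realType) (P : set 'rV[R]_2) : set 'rV[R]_2 :=
  [set X | P X /\
    forall (Y Z : 'rV[R]_2) (t : R), P Y -> P Z -> 0 < t -> t < 1 ->
      X = (1 - t) *: Y + t *: Z -> Y = Z].

Definition is_circumcenter (R : realType) (N : 'rV[R]_2 -> R)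
    (P : set 'rV[R]_2) (M : 'rV[R]_2) (r : R) : Prop :=
  0 < r /\ vertices P `<=` circle N M r.

(* conv {A_0, ..., A_d} has exactly the d + 1 distinct vertices A_0, ..., A_d,
   and they lie on the circle with center M and radius r. *)
Definition is_cyclic_polygon (R : realType) (N : 'rV[R]_2 -> R) (d : nat)
    (A : 'I_d.+1 -> 'rV[R]_2) (M : 'rV[R]_2) (r : R) : Prop :=
  [/\ injective A,
      vertices (convex_hull (range A)) = range A
    & is_circumcenter N (convex_hull (range A)) M r].

(* The index sets of the next two sums are the vertex sets of polygons, hence
   finite; fsbigop gives 0 on sets where the summand has infinite support. *)
Definition complementary_point (R : realType) (M : 'rV[R]_2)
    (P : set 'rV[R]_2) : 'rV[R]_2 :=
  M + \sum_(X \in vertices P) (X - M).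

Definition spatial_center (R : realType) (M : 'rV[R]_2)
    (P : set 'rV[R]_2) : 'rV[R]_2 :=
  M + 2^-1 *: \sum_(X \in vertices P) (X - M).

(* Main.v *)
Require Import Defs.
From mathcomp Require Import all_boot all_order all_algebra.
From mathcomp Require Import boolp classical_sets functions fsbigop reals.
From mathcomp Require Import cardinality interval_inference convex ring.
Import Order.TTheory GRing.Theory Num.Theory.
Local Open Scope classical_set_scope.
Local Open Scope ring_scope.

(** Write [v_j = A_j - M] and [S] for the sum of all the [v_j].  Since every
    [A_j] lies on the circle, [N v_j = r], and the whole theorem is a list of
    affine identities: [PM - PM_i = v_i], the points [midpoint (A_i) PM] and
    [CM] differ by [v_i / 2], so do [CM] and [CM_i], and [CM] is the midpoint
    of [A_i] and [PM_i] because the term [A_i] missing in [PM_i] is put back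
    by averaging with [A_i].

    These identities presuppose that the two centers, defined as sums over the
    extreme points of the polygon, are the sums over the expected vertices.
    For the polygon itself this is a hypothesis, but for the subpolygon with
    [A_i] removed it has to be proved: the extreme points of
    [convex_hull (range A `\ A i)] are the [A_j] with [j <> i].  An extreme
    point of a hull always belongs to the generating set
    ([vertices_convex_hull_sub]), and a point that is extreme in the larger
    hull stays extreme in a smaller one that contains it
    ([vertices_sub]). *)

Lemma convex_bigcap (R : realType) (F : set (set 'rV[R]_2)) :
  (forall C, F C -> @convex_set R 'rV[R]_2 C) ->
  @convex_set R 'rV[R]_2 (\bigcap_(C in F) C).
Proof.
move=> Fconv x y l /set_mem xF /set_mem yF; apply/mem_set => C FC.
by apply/set_mem/Fconv => //; apply/mem_set; [exact: xF|exact: yF].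
Qed.

Lemma convex_convex_hull (R : realType) (F : set 'rV[R]_2) :
  @convex_set R 'rV[R]_2 (convex_hull F).
Proof. by apply: convex_bigcap => C -[]. Qed.

Lemma convex_hullS (R : realType) (F G : set 'rV[R]_2) :
  F `<=` G -> convex_hull F `<=` convex_hull G.
Proof. by apply: sub_smallest2r; exact: convex_convex_hull. Qed.

Lemma vertices_sub (R : realType) (P Q : set 'rV[R]_2) (X : 'rV[R]_2) :
  Q `<=` P -> vertices P X -> Q X -> vertices Q X.
Proof.
by move=> QP [_ extX] QX; split=> // Y Z t /QP PY /QP PZ; exact: extX.
Qed.

(** Deleting an extreme point from a convex set leaves a convex set.  If the
    point were not a generator, the rest of the hull would be a smaller convex
    set containing all generators. *)
Lemma vertices_convex_hull_sub (R : realType) (F : set 'rV[R]_2) :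
  vertices (convex_hull F) `<=` F.
Proof.
move=> X [hX extX]; apply: contrapT => nFX.
suff : convex_hull F `<=` convex_hull F `\ X.
  by move=> /(_ X hX)[_]; apply.
apply: smallest_sub; last first.
  move=> Y FY; split; first exact: sub_gen_smallest.
  by move=> YX; apply: nFX; rewrite -YX.
apply/convex_setW => y z /set_mem[hy yX] /set_mem[hz zX] k k0 k1.
apply/mem_set; split.
  by apply/set_mem/convex_convex_hull; exact/mem_set.
move=> /= yzX.
have zy : z = y.
  by apply: (extX z y k%:num) => //; rewrite -yzX addrC.
by apply: yX; rewrite -yzX zy convmm.
Qed.

(** Nothing new becomes extreme when a generator is removed, and what was
    extreme in the larger hull remains so. *)
Lemma vertices_convex_hull_setD1 (R : realType) (F : set 'rV[R]_2)
    (X : 'rV[R]_2) :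
  vertices (convex_hull F) = F -> vertices (convex_hull (F `\ X)) = F `\ X.
Proof.
move=> vF; apply/seteqP; split; first exact: vertices_convex_hull_sub.
move=> Y FXY; apply: (@vertices_sub _ (convex_hull F)).
- by apply: convex_hullS => Z [].
- by rewrite vF; case: FXY.
- exact: sub_gen_smallest.
Qed.

Lemma fsum_range (I : finType) (T : choiceType) (V : nmodType) (A : I -> T)
    (f : T -> V) :
  injective A -> \sum_(X \in range A) f X = \sum_i f (A i).
Proof.
move=> injA; rewrite fsbig_image; last by move=> i j _ _; exact: injA.
rewrite (fsbigE (index_enum I)) ?index_enum_uniq//.
- by apply: eq_bigl => i; rewrite in_setT.
- by move=> i _ /=; rewrite mem_index_enum.
Qed.

Lemma fsum_range_setD1 (I : finType) (T : choiceType) (V : zmodType)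
    (A : I -> T) (f : T -> V) (i : I) :
  injective A ->
  \sum_(X \in range A `\ A i) f X = \sum_j f (A j) - f (A i).
Proof.
move=> injA; rewrite -(fsum_range _ _ _ _ _ injA) [in RHS](fsbigD1 (A i))/=.
- by rewrite addrC addrK.
- exact/finite_image/finite_finset.
- by exists i.
Qed.

Lemma is_normN (R : realType) (N : 'rV[R]_2 -> R) (v : 'rV[R]_2) :
  is_norm N -> N (- v) = N v.
Proof. by case=> _ NZ _; rewrite -scaleN1r NZ normrN1 mul1r. Qed.

Lemma is_norm_half (R : realType) (N : 'rV[R]_2 -> R) (v : 'rV[R]_2) :
  is_norm N -> N (2^-1 *: v) = N v / 2.
Proof. by case=> _ NZ _; rewrite NZ ger0_norm ?invr_ge0// mulrC. Qed.

Theorem theorem5p1 (R : realType) (N : 'rV[R]_2 -> R) (hN : is_norm N)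
    (d : nat) (hd : (3 <= d)%N) (A : 'I_d.+1 -> 'rV[R]_2) (M : 'rV[R]_2)
    (r : R) (hP : is_cyclic_polygon N A M r) :
  let P := convex_hull (range A) in
  let P_ (i : 'I_d.+1) := convex_hull (range A `\ A i) in
  let PM := complementary_point M P in
  let PM_ (i : 'I_d.+1) := complementary_point M (P_ i) in
  let CM := M + 2^-1 *: \sum_(i < d.+1) (A i - M) in
  let CM_ (i : 'I_d.+1) := spatial_center M (P_ i) in
  [/\ (* (a) *)
      forall i, circle N (PM_ i) r PM,
      (* (b) *)
      [/\ CM = spatial_center M P,
          CM = midpoint M PM
        & forall i, A i <> PM_ i -> line (A i) (PM_ i) CM],
      (* (c) *)
      forall i, circle N CM (r / 2) (midpoint (A i) PM)
    & (* (d) *)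
      (forall i, circle N (CM_ i) (r / 2) CM)
      /\ (forall i, circle N CM (r / 2) (CM_ i))].
Proof.
case: hP => injA vP [_ onCircle] P P_ PM PM_ CM CM_.
have NA i : N (A i - M) = r.
  by apply: onCircle; rewrite vP; exists i.
pose S := \sum_(i < d.+1) (A i - M).
have PME : PM = M + S.
  by rewrite /PM /complementary_point vP fsum_range.
have CME : CM = M + 2^-1 *: S by [].
have PM_E i : PM_ i = M + (S - (A i - M)).
  rewrite /PM_ /complementary_point vertices_convex_hull_setD1//.
  by rewrite fsum_range_setD1.
have CM_E i : CM_ i = M + 2^-1 *: (S - (A i - M)).
  rewrite /CM_ /spatial_center vertices_convex_hull_setD1//.
  by rewrite fsum_range_setD1.
have CMsub i : CM - CM_ i = 2^-1 *: (A i - M).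
  by rewrite CME CM_E; apply/rowP => k; rewrite !mxE; field.
split.
- move=> i; rewrite /circle /= PME PM_E -(NA i); congr N.
  by apply/rowP => k; rewrite !mxE; ring.
- split.
  + by rewrite /spatial_center vP fsum_range.
  + by rewrite CME PME; apply/rowP => k; rewrite !mxE; field.
  + move=> i _; exists 2^-1 => //.
    by rewrite CME PM_E; apply/rowP => k; rewrite !mxE; field.
- move=> i; rewrite /circle /= -(NA i) -is_norm_half//; congr N.
  by rewrite CME PME; apply/rowP => k; rewrite !mxE; field.
- split=> i; rewrite /circle /=.
  + by rewrite CMsub is_norm_half// NA.
  + by rewrite -opprB is_normN// CMsub is_norm_half// NA.
Qed.
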